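(* For all integers $m,n$ with $2 \leq m \leq n$, $\mathrm{dom}_t(K_{m,n}) = 4$.
   Context: An orientation of a (finite simple) graph $G$ is a digraph obtained by directing each edge $uv$ of $G$ in exactly one of the two directions $(u,v)$ or $(v,u)$. The orientation is valid if every vertex has in-degree at least $1$. A set $S\subseteq V(D)$ is a total dominating set of a digraph $D$ if every vertex of $D$ (including those in $S$) has an in-neighbor in $S$; $\gamma_t(D)$ is the minimum cardinality of a total dominating set of $D$. For a graph $G$ in which every component contains a cycle (equivalently, $G$ has a valid orientation), $\mathrm{dom}_t(G)$ is the minimum of $\gamma_t(D)$ over all valid orientations $D$ of $G$. $K_{m,n}$ is the complete bipartite graph with parts of sizes $m$ and $n$. *)

(* Defs.v *)
From mathcomp Require Import all_boot.

Set Implicit Arguments.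
Unset Strict Implicit.
Unset Printing Implicit Defensive.

(* Minimum of F over the indices satisfying P; 0 if there is no such index. *)
Definition minval (I : finType) (P : pred I) (F : I -> nat) : nat :=
  if [pick i | P i] is Some i0 then F [arg min_(i < i0 | P i) F i] else 0.

Lemma minvalP (I : finType) (P : pred I) (F : I -> nat) (i0 : I) :
  P i0 ->
  (exists2 i, P i & F i = minval P F) /\ (forall j, P j -> minval P F <= F j).
Proof.
rewrite /minval => Pi0; case: pickP => [i1 Pi1 | /(_ i0)]; last by rewrite Pi0.
by case: arg_minnP => // i Pi imin; split; first exists i.
Qed.

Record sgraph := SGraph {
  vertex :> finType;
  adj : rel vertex;
  adj_sym : symmetric adj;
  adj_irrefl : irreflexive adj
}.

(* A digraph on T is its set of arcs: (u, v) \in D is the arc from u to v. *)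
Definition digraph (T : finType) := {set T * T}.

Section Digraph.
Variables (T : finType) (D : digraph T).

Definition in_neighbors (v : T) : {set T} := [set u | (u, v) \in D].

Definition total_dominating (S : {set T}) : bool :=
  [forall v, exists u in S, u \in in_neighbors v].

Definition gamma_t : nat := minval total_dominating (fun S : {set T} => #|S|).

End Digraph.

Section Orientation.
Variable G : sgraph.

Definition is_orientation (D : digraph G) : bool :=
  [forall u, forall v,
     if adj u v then ((u, v) \in D) (+) ((v, u) \in D) else (u, v) \notin D].

Definition valid_orientation (D : digraph G) : bool :=
  is_orientation D && [forall v, 1 <= #|in_neighbors D v|].

(* Meaningful when G has a valid orientation; 0 otherwise. *)
Definition dom_t : nat := minval valid_orientation (@gamma_t G).

End Orientation.

Section CompleteBipartite.
Variables m n : nat.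

Definition bip_adj (u v : 'I_m + 'I_n) : bool :=
  match u, v with
  | inl _, inr _ | inr _, inl _ => true
  | _, _ => false
  end.

Lemma bip_adj_sym : symmetric bip_adj.
Proof. by move=> [u|u] [v|v]. Qed.

Lemma bip_adj_irrefl : irreflexive bip_adj.
Proof. by move=> [u|u]. Qed.

Definition complete_bipartite : sgraph := SGraph bip_adj_sym bip_adj_irrefl.

End CompleteBipartite.

(* Main.v *)
Require Import Defs.
From mathcomp Require Import all_boot.

(** Lower bound: in an orientation of a bipartite graph, a total dominating
    set [S] lets one walk backwards along arcs without ever leaving [S].  Four
    consecutive vertices of such a walk are distinct: neighbours on the walk,
    and vertices three steps apart, lie on opposite sides, while a vertex cannot
    recur after two steps, since that would use both directions of one edge.
    Hence [4 <= #|S|] (lemma [total_dominating_card_ge4]).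

    Upper bound: orient the 4-cycle on two vertices of each side cyclically.
    These four vertices dominate one another, and the edges from them to each
    remaining vertex can be directed so that one of them dominates it.  The
    orientation [xor_orientation] does all of this with a single formula. *)

Lemma orientation_asym (G : sgraph) (D : digraph G) (u v : G) :
  is_orientation D -> (u, v) \in D -> (v, u) \notin D.
Proof.
move=> /forallP/(_ u)/forallP/(_ v); case: ifP => _; last by move=> /negP.
by move=> + Duv; rewrite Duv.
Qed.

Lemma orientation_adj (G : sgraph) (D : digraph G) (u v : G) :
  is_orientation D -> (u, v) \in D -> adj u v.
Proof.
by move=> /forallP/(_ u)/forallP/(_ v); case: ifP => // _ /negP.
Qed.

(** Domination of [v0] starts the backward walk, and domination of each vertex
    of the walk extends it inside [S].  The proper 2-colouring [side] separates
    vertices at odd distance along the walk, asymmetry of [D] those at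
    distance two. *)
Lemma total_dominating_card_ge4 (G : sgraph) (side : G -> bool)
    (D : digraph G) (S : {set G}) (v0 : G) :
  (forall u v : G, adj u v -> side u != side v) ->
  is_orientation D -> total_dominating D S -> 4 <= #|S|.
Proof.
move=> bip oD /forallP domS.
have pred_in v : exists2 u, u \in S & (u, v) \in D.
  by have /exists_inP[u Su] := domS v; rewrite inE; exists u.
have [a Sa _] := pred_in v0; have [b Sb Dba] := pred_in a.
have [c Sc Dcb] := pred_in b; have [d Sd Ddc] := pred_in c.
have arc_side u v : (u, v) \in D -> side u = ~~ side v.
  by move=> /(orientation_adj _ _ _ _ oD)/bip; case: (side u) (side v) => [] [].
have sb := arc_side _ _ Dba; have sc := arc_side _ _ Dcb.
have sd := arc_side _ _ Ddc.
have uniq_walk : uniq [:: a; b; c; d].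
  have neq u v : side u != side v -> u != v by apply: contraNneq => ->.
  have ac : a != c.
    by apply: contraTneq Dcb => <-; apply: orientation_asym oD Dba.
  have bd : b != d.
    by apply: contraTneq Ddc => <-; apply: orientation_asym oD Dcb.
  have ab : a != b by apply: neq; rewrite sb; case: (side a).
  have bc : b != c by apply: neq; rewrite sc; case: (side b).
  have cd : c != d by apply: neq; rewrite sd; case: (side c).
  have ad : a != d by apply: neq; rewrite sd sc sb; case: (side a).
  by rewrite /= !inE !negb_or ab ac ad bc bd cd.
rewrite -[4]/(size [:: a; b; c; d]) -(card_uniqP uniq_walk).
by apply/subset_leq_card/subsetP => x; rewrite !inE => /or4P[] /eqP->.
Qed.

(** The edge [inl i -- inr j] leaves [inl i] when exactly one of [i = 0] and
    [j = 1] holds, and enters it otherwise.  On [i, j < 2] this is the directed 4-cycle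
    [inl 0 -> inr 0 -> inl 1 -> inr 1 -> inl 0]. *)
Definition xor_orientation (m n : nat) : digraph (complete_bipartite m n) :=
  [set e : ('I_m + 'I_n) * ('I_m + 'I_n) |
    match e with
    | (inl i, inr j) => (val i == 0) (+) (val j == 1)
    | (inr j, inl i) => ~~ ((val i == 0) (+) (val j == 1))
    | _ => false
    end].

Lemma xor_orientationP (m n : nat) : is_orientation (xor_orientation m n).
Proof.
by apply/forallP => -[i|i]; apply/forallP => -[j|j]; rewrite /= !inE //=;
  rewrite ?addbN ?addNb addbb.
Qed.

Lemma xor_orientation_dominated (m n : nat) : 2 <= m -> 2 <= n ->
  exists2 S, total_dominating (xor_orientation m n) S & #|S| <= 4.
Proof.
move=> m_ge2 n_ge2.
pose l0 : 'I_m := Ordinal (ltnW m_ge2); pose l1 : 'I_m := Ordinal m_ge2.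
pose r0 : 'I_n := Ordinal (ltnW n_ge2); pose r1 : 'I_n := Ordinal n_ge2.
pose s : seq (complete_bipartite m n) := [:: inl l0; inl l1; inr r0; inr r1].
exists [set x in s]; last by rewrite cardsE; apply: card_size.
apply/forallP => -[i|j]; apply/exists_inP.
- (* [inr 1] dominates [inl 0], and [inr 0] the rest of the left side. *)
  have [i0|i0] := eqVneq (val i) 0.
    by exists (inr r1); rewrite !inE ?eqxx ?orbT //= i0.
  by exists (inr r0); rewrite !inE ?eqxx ?orbT //= (negPf i0).
- (* [inl 1] dominates [inr 1], and [inl 0] the rest of the right side. *)
  have [j1|j1] := eqVneq (val j) 1.
    by exists (inl l1); rewrite !inE ?eqxx ?orbT //= j1.
  by exists (inl l0); rewrite !inE ?eqxx ?orbT //= (negPf j1).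
Qed.

(** The default value of a minimum over nothing must be ruled out for
    [gamma_t]: validity is what makes the set of all vertices dominating. *)
Lemma valid_total_dominating (G : sgraph) (D : digraph G) :
  is_orientation D ->
  valid_orientation D <-> exists S, total_dominating D S.
Proof.
rewrite /valid_orientation => ->; split=> [/forallP indeg | [S /forallP domS]].
  exists [set: G]; apply/forallP => v; apply/exists_inP.
  by have /card_gt0P[u uv] := indeg v; exists u; first exact: in_setT.
apply/forallP => v; apply/card_gt0P.
by have /exists_inP[u _ uv] := domS v; exists u.
Qed.

Theorem proposition3p4 (m n : nat) (hm : 2 <= m) (hmn : m <= n) :
  dom_t (complete_bipartite m n) = 4.
Proof.
have [S0 domS0 S0_le4] := xor_orientation_dominated m n hm (leq_trans hm hmn).
have oD0 := xor_orientationP m n.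
have validD0 : valid_orientation (xor_orientation m n).
  by apply/(valid_total_dominating _ _ oD0); exists S0.
have [[D validD domt_eq] domt_min] :=
  minvalP (@gamma_t (complete_bipartite m n)) validD0.
apply/eqP; rewrite eqn_leq; apply/andP; split.
  apply: leq_trans (domt_min _ validD0) (leq_trans _ S0_le4).
  have [_ gamma_min] :=
    minvalP (fun S : {set complete_bipartite m n} => #|S|) domS0.
  exact: gamma_min.
have oD : is_orientation D by case/andP: validD.
have /(valid_total_dominating _ _ oD)[S1 domS1] := validD.
rewrite /dom_t -domt_eq.
rewrite /gamma_t; have [[S domS <-] _] :=
  minvalP (fun S : {set complete_bipartite m n} => #|S|) domS1.
pose side (x : complete_bipartite m n) := if x is inl _ then true else false.
apply: (total_dominating_card_ge4 _ side D S (inl (Ordinal hm))) => //.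
by move=> [u|u] [v|v].
Qed.
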